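(* Let $\kappa$ be a regular uncountable cardinal. Then $\mathrm{IP}(\kappa,\aleph_1)$ implies $\mathrm F^{\mathrm s}(\kappa)$.
   Context: Notation. For a set $X$ and $n\in\omega$, $((X))^n$ is the set of injective $n$-tuples of elements of $X$, and $((X))^{<\omega}=\bigcup_{n<\omega}((X))^n$. For sets $X_0,\dots,X_{n-1}$, $((X_0,\dots,X_{n-1}))$ is the set of injective tuples in $X_0\times\cdots\times X_{n-1}$. $f''S$ is the image of $S$ under $f$. $\omega^{<\omega}$ is the set of finite sequences of natural numbers, $|t|$ is the length of $t$, and an intersection of subsets of $\omega$ over an empty index set is read as $\omega$. $\mathcal H(\aleph_1)$ is the set of hereditarily countable sets. A set $A\subseteq\mathcal H(\aleph_1)$ is definable if there are a formula $\varphi$ of the language of set theory and $a\in\mathcal H(\aleph_1)$ with $A=\{x\in\mathcal H(\aleph_1):\langle\mathcal H(\aleph_1),\in\rangle\models\varphi(x,a)\}$; a function is definable if its graph is. $\mathrm{IP}(\kappa,\lambda)$ (for cardinals $\lambda\le\kappa$): for any $f:\kappa\to\mathcal P(\omega)$ and any definable $g:((\mathcal P(\omega)))^{<\omega}\to\mathcal P(\omega)$, at least one of the following holds: (i0) there is a stationary $S\subseteq\kappa$ such that $|g''((f''S))^n|<\lambda$ for every $n\in\omega$; (i1) there are $k\in\omega\setminus\{0\}$ and stationary $S_0,\dots,S_{k-1}\subseteq\kappa$ such that for any $\langle x_0,\dots,x_{k-1}\rangle,\langle y_0,\dots,y_{k-1}\rangle\in((f''S_0,\dots,f''S_{k-1}))$,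 if $x_n\ne y_n$ for all $n<k$ then $g(x_0,\dots,x_{k-1})\neq g(y_0,\dots,y_{k-1})$. $\mathrm F^{\mathrm s}(\kappa)$: for any $T\subseteq\omega^{<\omega}$ and any matrix $\langle a_{\alpha,n}:\alpha<\kappa,n\in\omega\rangle$ of subsets of $\omega$, at least one of the following holds: (f0) there is a stationary $S\subseteq\kappa$ such that the set $\{\bigcap_{n<|t|}a_{\alpha_n,t(n)}: t\in T,\ \langle\alpha_0,\dots,\alpha_{|t|-1}\rangle\in((S))^{|t|}\}$ is countable; (f1) there are $t\in T$ and stationary $S_0,\dots,S_{|t|-1}\subseteq\kappa$ such that for all $\langle\alpha_0,\dots,\alpha_{|t|-1}\rangle,\langle\beta_0,\dots,\beta_{|t|-1}\rangle\in((S_0,\dots,S_{|t|-1}))$, if $\alpha_n\ne\beta_n$ for all $n<|t|$ then $\bigcap_{n<|t|}a_{\alpha_n,t(n)}\ne\bigcap_{n<|t|}a_{\beta_n,t(n)}$. *)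

(* Defs.v *)
From mathcomp Require Import all_boot all_order.
From mathcomp Require Import boolp classical_sets functions cardinality wochoice.

Set Implicit Arguments.
Unset Strict Implicit.
Unset Printing Implicit Defensive.

Import Order.TTheory.

Local Open Scope classical_set_scope.
Local Open Scope card_scope.

(* Cardinals are represented by well-ordered types that are initial ordinals. *)

Definition card_lt (T U : Type) (A : set T) (B : set U) : Prop :=
  A #<= B /\ ~ (B #<= A).

Definition is_cardinal d (K : orderType d) : Prop :=
  well_order (<=%O : rel K) /\
  forall a : K, card_lt [set b : K | (b < a)%O] [set: K].

(* The hypothesis on [h] concerns only its restriction to the initial segment
   below [a], i.e. a function from an ordinal smaller than K to K; such a
   function is required not to be cofinal. *)
Definition is_regular d (K : orderType d) : Prop :=
  is_cardinal K /\
  forall (a : K) (h : K -> K),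
    exists b : K, forall c : K, (c < a)%O -> (h c < b)%O.

Definition regular_uncountable d (K : orderType d) : Prop :=
  is_regular K /\ ~ countable [set: K].

Definition is_aleph1 d (L : orderType d) : Prop :=
  [/\ is_cardinal L, ~ countable [set: L] &
      forall a : L, countable [set b : L | (b < a)%O]].

(* [C] is closed when it contains every limit [a] with sup (C `&` a) = a; the
   two premises on [a] say exactly that [a] is such a limit. *)
Definition club d (K : orderType d) (C : set K) : Prop :=
  (forall a : K, exists2 c, C c & (a < c)%O) /\
  (forall a : K,
      (exists b : K, (b < a)%O) ->
      (forall b : K, (b < a)%O -> exists2 c, C c & (b < c < a)%O) ->
      C a).

Definition stationary d (K : orderType d) (S : set K) : Prop :=
  forall C : set K, club C -> S `&` C !=set0.

Definition inj_prod (T : Type) k (X : 'I_k -> set T) : set ('I_k -> T) :=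
  [set x | injective x /\ forall i, X i (x i)].

Definition inj_tuples (T : Type) n (X : set T) : set ('I_n -> T) :=
  inj_prod (fun _ : 'I_n => X).

(** * The structure of hereditarily countable sets

  [HSet u] denotes the set of all x such that [u i = Some x] for some [i], so
  that the well-founded trees [hc] denote exactly the hereditarily countable
  sets.  Two trees denote the same set iff they are related by [hc_eq], hence
  H(aleph_1) is [hc] with [hc_eq] as equality and [hc_mem] as membership. *)

Inductive hc : Type := HSet of (nat -> option hc).

Fixpoint hc_eq (x y : hc) : Prop :=
  let: HSet u := x in
  let: HSet v := y in
  (forall i, if u i is Some x' then
     exists j, if v j is Some y' then hc_eq x' y' else False else True) /\
  (forall j, if v j is Some y' then
     exists i, if u i is Some x' then hc_eq x' y' else False else True).

Definition hc_mem (x y : hc) : Prop :=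
  let: HSet v := y in exists j, if v j is Some y' then hc_eq x y' else False.

(* First-order formulas in the language {=, in}, with de Bruijn indices. *)
Inductive formula : Type :=
| FEq of nat & nat
| FMem of nat & nat
| FNot of formula
| FAnd of formula & formula
| FEx of formula.

Definition hc_empty : hc := HSet (fun _ => None).

(* The free variable [i] is interpreted by [nth hc_empty e i]. *)
Fixpoint sat (e : seq hc) (phi : formula) : Prop :=
  match phi with
  | FEq i j => hc_eq (nth hc_empty e i) (nth hc_empty e j)
  | FMem i j => hc_mem (nth hc_empty e i) (nth hc_empty e j)
  | FNot p => ~ sat e p
  | FAnd p q => sat e p /\ sat e q
  | FEx p => exists x : hc, sat (x :: e) p
  end.

Definition definable (A : set hc) : Prop :=
  exists (phi : formula) (a : hc), forall x : hc, A x <-> sat [:: x; a] phi.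

(* x union {y} *)
Definition hc_adjoin (x y : hc) : hc :=
  let: HSet u := x in HSet (fun i => if i is j.+1 then u j else Some y).

(* von Neumann numerals *)
Fixpoint hc_nat (n : nat) : hc :=
  if n is m.+1 then hc_adjoin (hc_nat m) (hc_nat m) else hc_empty.

Definition hc_set (A : set nat) : hc :=
  HSet (fun i => if i \in A then Some (hc_nat i) else None).

Definition hc_upair (x y : hc) : hc :=
  hc_adjoin (hc_adjoin hc_empty x) y.

(* Kuratowski ordered pairs *)
Definition hc_pair (x y : hc) : hc := hc_upair (hc_upair x x) (hc_upair x y).

(* A finite sequence is a function whose domain is a von Neumann numeral. *)
Definition hc_tuple n (x : 'I_n -> hc) : hc :=
  HSet (fun i => omap (fun j : 'I_n => hc_pair (hc_nat j) (x j)) (insub i)).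

(** * Definable functions from ((P(omega)))^{<omega} to P(omega)

  The function is given on each length [n] separately.  Only its values at
  injective tuples count, its domain being ((P(omega)))^{<omega}. *)

Definition tuple_fun : Type := forall n, ('I_n -> set nat) -> set nat.

Definition hc_graph (g : tuple_fun) : set hc :=
  [set z | exists n (x : 'I_n -> set nat),
     injective x /\
     hc_eq z (hc_pair (hc_tuple (fun i => hc_set (x i))) (hc_set (g n x)))].

Definition definable_fun (g : tuple_fun) : Prop := definable (hc_graph g).

Definition IP d d' (K : orderType d) (L : orderType d') : Prop :=
  forall (f : K -> set nat) (g : tuple_fun), definable_fun g ->
  (exists S : set K, stationary S /\
     forall n : nat, card_lt (g n @` inj_tuples (f @` S)) [set: L])
  \/
  (exists (k : nat) (S : 'I_k -> set K),
     [/\ (0 < k)%N, forall i, stationary (S i) &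
         forall x y : 'I_k -> set nat,
           inj_prod (fun i => f @` S i) x ->
           inj_prod (fun i => f @` S i) y ->
           (forall i, x i <> y i) -> g k x <> g k y]).

(* For [t] empty this is the intersection of an empty family, i.e. [setT]. *)
Definition meet_along (K : Type) (a : K -> nat -> set nat) (t : seq nat)
    (alpha : 'I_(size t) -> K) : set nat :=
  \bigcap_(i in [set: 'I_(size t)]) a (alpha i) (nth 0%N t i).

Definition Fs d (K : orderType d) : Prop :=
  forall (T : set (seq nat)) (a : K -> nat -> set nat),
  (exists S : set K, stationary S /\
     countable [set X | exists t (alpha : 'I_(size t) -> K),
       [/\ T t, inj_tuples S alpha & X = meet_along a alpha]])
  \/
  (exists (t : seq nat) (S : 'I_(size t) -> set K),
     [/\ T t, forall i, stationary (S i) &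
         forall alpha beta : 'I_(size t) -> K,
           inj_prod S alpha -> inj_prod S beta ->
           (forall i, alpha i <> beta i) ->
           meet_along a alpha <> meet_along a beta]).

(* Main.v *)
Require Import Defs.
From mathcomp Require Import all_boot all_order.
From mathcomp Require Import boolp classical_sets functions cardinality wochoice.
From Stdlib Require Import Setoid.

Set Implicit Arguments.
Unset Strict Implicit.
Unset Printing Implicit Defensive.

Import Order.TTheory.

Local Open Scope classical_set_scope.
Local Open Scope card_scope.

(** The matrix is turned into a single function [f : K -> P(omega)] by letting
    [f c] code the whole row [a c], and all the intersections along elements of
    [T] are computed by one definable function [g].

    The difficulty is that [g] has one value on each tuple, while many [t] in
    [T] may have the same length.  So [t] is assigned its own number of
    arguments, an injective code [arity t > size t]: on tuples of that length
    [g] decodes the first [size t] arguments and intersects the relevant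
    columns, and it ignores the other arguments.  On lengths that are not of the
    form [arity t], [g] is constantly [omega].  Then the first alternative of
    [IP], applied to all lengths at once, says that the set of all meets is a
    countable union of countable sets; the second one, at a length [k], says
    that meets are separated along the [t] with [arity t = k], and there must be
    such a [t] because a constant function separates nothing.

    Going from tuples of length [size t] to tuples of length [arity t] is
    possible because stationary sets are unbounded, so that fresh indices can be
    appended ([extend_tuples]).  But injective tuples of indices are sent
    by [f] to injective tuples of reals only if [f] is injective.  By a diagonal
    intersection argument ([stationary_fibre_or_injection]), either the rows are
    constant on a stationary set, for which the meets are countably many since
    [T] is countable, or [K] injects into the set of matrix rows; in the latter
    case the image of [c] under such an injection is added to the code [f c].

    For the definability of [g] ([definable_rel_fun]), all the arithmetic
    involved (the coding of [T], of rows and of pairs) is put in a parameter: a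
    four-place relation on numbers, which is a hereditarily countable set.  What
    remains is a formula saying that a pair consists of an injective finite
    sequence of subsets of [omega] and of the set of those [m] such that the
    sequence meets all the requirements listed by the relation. *)

(** * Well-orders *)

Lemma injective_card_le (T U : Type) (f : T -> U) (B : set U) :
  injective f -> (forall x, B (f x)) -> [set: T] #<= B.
Proof.
move=> f_inj fB; have [|g] := (@injfunPex _ _ [set: T] B).2; last exact: inj_card_le.
by exists f => // x y _ _ /f_inj.
Qed.

Lemma exists_least d (K : orderType d) (P : set K) :
    well_order (<=%O : rel K) -> P !=set0 ->
  exists2 x, P x & forall y, P y -> (x <= y)%O.
Proof.
move=> woK [x Px].
have [|z [[zP zmin] _]] := woK [pred y | `[< P y >]].
  by exists x; exact/asboolP.
exists z; first exact/asboolP.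
by move=> y Py; apply: zmin; exact/asboolP.
Qed.

Lemma lt_wf d (K : orderType d) :
  well_order (<=%O : rel K) -> well_founded (fun x y : K => (x < y)%O).
Proof.
move=> woK a; apply: contrapT => nacc.
have [m nm lem] := @exists_least _ K (fun x => ~ Acc _ x) woK (ex_intro _ a nacc).
apply: nm; constructor => y ltym; apply: contrapT => /lem.
by rewrite leNgt ltym.
Qed.

(** By well-founded recursion, each point is sent to an element of [D] that is
    not the image of an earlier point.  The default [t0] only serves to extend
    partial functions to [K]. *)
Lemma injection_of_uncovered d (K : orderType d) (T : Type) (D : set T) (t0 : T) :
    well_order (<=%O : rel K) ->
    (forall (a : K) (h : K -> T),
       exists2 t, D t & forall c, (c < a)%O -> h c <> t) ->
  exists2 e : K -> T, injective e & forall a, D (e a).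
Proof.
move=> woK unc.
have step (a : K) (rec : forall c, (c < a)%O -> T) :
    {t | D t & forall c (lt_ca : (c < a)%O), rec c lt_ca <> t}.
  apply: cid2.
  pose h c := if pselect (c < a)%O is left lt_ca then rec c lt_ca else t0.
  have [t Dt tP] := unc a h; exists t => // c lt_ca.
  have := tP c lt_ca; rewrite /h; case: pselect => // lt_ca'.
  by rewrite (bool_irrelevance lt_ca lt_ca').
pose F a rec := s2val (step a rec).
pose e := Fix (lt_wf woK) (fun=> T) F.
have eE a : e a = F a (fun c _ => e c).
  apply: Fix_eq => x f g fg; congr F.
  by apply: functional_extensionality_dep => c; apply: funext => p.
exists e => [a b eab|a]; last by rewrite eE /F; case: (step a _).
have fresh c x : (c < x)%O -> e c <> e x.
  by move=> cx; rewrite [e x]eE /F; case: (step x _) => t _ /= /(_ c cx).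
by case: (ltgtP a b) => // /fresh; rewrite eab.
Qed.

(** An uncountable set cannot be covered by the image of a proper initial
    segment of [L], so [L] would inject into it. *)
Lemma card_lt_aleph1_countable d (L : orderType d) (T : Type) (A : set T) :
  is_aleph1 L -> card_lt A [set: L] -> countable A.
Proof.
move=> [[woL _] _ ctL] [_ nLA]; apply: contrapT => nctA; apply: nLA.
have [t0 At0] : A !=set0 by apply/set0P/eqP => A0; apply: nctA; rewrite A0.
have [a h|e e_inj eA] := @injection_of_uncovered _ L T A t0 woL.
  apply: contrapT => noT; apply: nctA.
  have : countable (h @` [set c | (c < a)%O]).
    by apply: sub_countable (ctL a); exact: card_image_le.
  apply: sub_countable; apply: subset_card_le => t At; apply: contrapT => nt.
  by apply: noT; exists t => // c ca hct; apply: nt; exists c.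
exact: injective_card_le eA.
Qed.

(** * Clubs and stationary sets *)

Lemma serial_sequence (T : Type) (R : nat -> T -> T -> Prop) (a : T) :
  (forall n x, exists y, R n x y) ->
  exists u : nat -> T, u 0%N = a /\ forall n, R n (u n) (u n.+1).
Proof.
move=> /(_ _ _)/cid-/(_ _ _) nxt.
pose u := fix u n := if n is m.+1 then projT1 (nxt m (u m)) else a.
by exists u; split=> // n /=; case: (nxt n (u n)).
Qed.

Section RegularUncountable.
Variables (d : Order.disp_t) (K : orderType d) (hK : regular_uncountable K).

Let woK : well_order (<=%O : rel K).
Proof. by case: hK => -[[]]. Qed.

Let inhabited_K : inhabited K.
Proof.
apply: contrapT => nK; case: hK => _; apply.
suff -> : [set: K] = set0 by [].
by apply/seteqP; split=> // x _; apply: nK.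
Qed.

Lemma exists_gt (a : K) : exists b, (a < b)%O.
Proof.
have [[_ reg] nct] := hK.
have [x [y xy]] : exists x y : K, (x < y)%O.
  apply: contrapT => nlt; apply: nct; apply/countable_injP.
  exists (fun=> 0%N) => x y _ _ _; apply/eqP; apply: contrapT => /negP.
  by rewrite neq_lt => /orP[] ?; apply: nlt; [exists x, y|exists y, x].
by have [b /(_ _ xy)] := reg y (fun=> a); exists b.
Qed.

(** Regularity bounds functions on proper initial segments, so it is enough to
    find an infinite one, which surjects onto [nat].  If there were none, then a
    strictly increasing sequence would be unbounded, and [K] would be a countable
    union of finite sets. *)
Lemma sequence_bounded (u : nat -> K) : exists b, forall n, (u n < b)%O.
Proof.
have [[_ reg] nct] := hK.
have [a inf_a] : exists a : K, infinite_set [set c | (c < a)%O].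
  apply: contrapT => /forallNP fin; apply: nct.
  have [a0] := inhabited_K.
  have [v [_ v_inc]] := serial_sequence a0 (fun _ : nat => exists_gt).
  have [[b vb]|unb] := pselect (exists b, forall n, (v n < b)%O).
    exfalso; apply: (fin b); apply/infiniteP.
    apply: (@injective_card_le _ _ v) => // m n vmn; apply/eqP.
    by rewrite eqn_leq -!leEnat -!(Order.NatMonotonyTheory.incnP v_inc) vmn lexx.
  have -> : [set: K] = \bigcup_n [set c | (c <= v n)%O].
    apply/seteqP; split=> // c _; apply: contrapT => nc; apply: unb; exists c => n.
    by rewrite ltNge; apply/negP => cv; apply: nc; exists n.
  apply: bigcup_countable => // n _; apply: finite_set_countable.
  have [b vb] := exists_gt (v n).
  apply: (@sub_finite_set _ _ [set c | (c < b)%O]) => [c /= cv|].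
    exact: le_lt_trans vb.
  by apply: contrapT; exact: fin.
have /infiniteP/pcard_geP/surjPex[r r_surj] := inf_a.
have [b hb] := reg a (u \o r); exists b => n.
by have [c ca <-] := r_surj n I; exact: hb.
Qed.

Lemma countable_bounded (T : countType) (u : T -> K) :
  exists b, forall t, (u t < b)%O.
Proof.
have [a0] := inhabited_K.
have [b ub] := sequence_bounded (fun n => oapp u a0 (unpickle n)).
by exists b => t; have := ub (pickle t); rewrite pickleK.
Qed.

Lemma club_tail (a : K) : club [set b | (a < b)%O].
Proof.
split=> [b|b [c cb] lim]; last first.
  by have [e /= ae /andP[_ eb]] := lim c cb; exact: lt_trans eb.
have [c abc] := exists_gt (Order.max a b).
by exists c; move: abc; rewrite gt_max => /andP[].
Qed.

Lemma stationary_unbounded (S : set K) (a : K) :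
  stationary S -> exists2 b, S b & (a < b)%O.
Proof. by move=> /(_ _ (club_tail a)) [b [Sb ab]]; exists b. Qed.

(** The diagonal intersection of clubs is club: a point above [a] is obtained
    as the supremum of an increasing sequence, each step of which goes past an
    element of every [C b] with [b] below the previous step; regularity makes
    that step possible and bounds the sequence. *)
Lemma club_diagonal (C : K -> set K) :
  (forall b, club (C b)) -> club [set a | forall b, (b < a)%O -> C b a].
Proof.
move=> clubC; split=> [a|a a_pos lim b ba /=]; last first.
  apply: (clubC b).2 => // c ca.
  have [|e eD] := lim (Order.max b c); first by rewrite gt_max ba.
  rewrite gt_max => /andP[/andP[be ce] ea].
  by exists e; [exact: eD|rewrite ce].
pose R (n : nat) x y :=
  (x < y)%O /\ forall b, (b < x)%O -> exists2 c, C b c & (x < c < y)%O.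
have serial n x : exists y, R n x y.
  have /choice [h hP] : forall b, exists c, C b c /\ (x < c)%O.
    by move=> b; have [c Cc xc] := (clubC b).1 x; exists c.
  have [y hy] := hK.1.2 x h; have [z] := exists_gt (Order.max x y).
  rewrite gt_max => /andP[xz yz]; exists z; split=> // b bx.
  have [Chb xhb] := hP b.
  by exists (h b) => //; rewrite xhb (lt_trans (hy b bx)).
have [u [u0 uR]] := serial_sequence a serial.
have u_inc n : (u n < u n.+1)%O := (uR n).1.
have u_le m n : (m <= n)%N -> (u m <= u n)%O.
  by move=> mn; rewrite (Order.NatMonotonyTheory.incnP u_inc).
have [s us s_min] := exists_least woK (sequence_bounded u).
exists s => /=; last by rewrite -u0.
have below b : (b < s)%O -> exists n, (b < u n)%O.
  move=> bs; apply: contrapT => nb; have := s_min b; rewrite leNgt bs => H.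
  suff: false by []; apply: H => n; apply: (lt_le_trans (u_inc n)).
  by rewrite leNgt; apply/negP => ?; apply: nb; exists n.+1.
move=> b bs; have [m bm] := below b bs.
apply: (clubC b).2; first by exists b.
move=> c cs; have [n cn] := below c cs.
have [|e Ce /andP[ue eu]] := (uR (maxn m n)).2 b.
  exact: lt_le_trans bm (u_le _ _ (leq_maxl _ _)).
exists e => //; rewrite (lt_trans eu) ?us // andbT.
exact: lt_trans (lt_le_trans cn (u_le _ _ (leq_maxr _ _))) ue.
Qed.

(** If no fibre is stationary, choose for every [b] a club avoiding the fibre of
    [b]: [f] is injective on the diagonal intersection of these clubs, an
    unbounded set, into which [K] injects by regularity. *)
Lemma stationary_fibre_or_injection (T : Type) (f : K -> T) :
  (exists b, stationary [set a | f a = f b]) \/ exists e : K -> T, injective e.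
Proof.
have [|nst] := pselect (exists b, stationary [set a | f a = f b]); first by left.
right; have [a0] := inhabited_K.
have /choice [C CP] : forall b, exists C, club C /\ forall c, C c -> f c <> f b.
  move=> b; apply: contrapT => nC; apply: nst; exists b => C clubC.
  apply: contrapT => disj; apply: nC; exists C; split=> // c Cc fcb.
  by apply: disj; exists c.
have clubD := club_diagonal (fun b => (CP b).1).
set D := [set a | _] in clubD.
have f_injD : {in D &, injective f}.
  have fresh b c : D c -> (b < c)%O -> f c <> f b.
    by move=> Dc /Dc; exact: (CP b).2.
  move=> b c; rewrite !inE => Db Dc fbc.
  by case: (ltgtP b c) => // /fresh fr; case: fr.
have [a h|e e_inj eD] := @injection_of_uncovered _ K K D a0 woK.
  have [b hb] := hK.1.2 a h; have [c Dc bc] := clubD.1 b.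
  by exists c => // x xa hx; have := lt_trans (hb x xa) bc; rewrite hx ltxx.
by exists (f \o e) => a b /f_injD eab; apply/e_inj/eab; rewrite inE.
Qed.

Lemma fresh_points (I : countType) (U : I -> set K) (b : K) :
    (forall i (a : K), exists2 c, U i c & (a < c)%O) ->
  exists w : I -> K, [/\ injective w, forall i, U i (w i) & forall i, (b < w i)%O].
Proof.
move=> unb.
pose R n (x y : K) := (x < y)%O /\ if unpickle n is Some i then U i y else True.
have serial n x : exists y, R n x y.
  rewrite /R; case: unpickle => [i|].
    by have [c Uc xc] := unb i x; exists c.
  by have [c xc] := exists_gt x; exists c.
have [u [u0 uR]] := serial_sequence b serial.
have u_inc n : (u n < u n.+1)%O := (uR n).1.
exists (fun i => u (pickle i).+1); split=> [i j uij|i|i].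
- apply: (pcan_inj pickleK); apply/eqP.
  have u_le m n : (m <= n)%N = (u m.+1 <= u n.+1)%O.
    by rewrite (Order.NatMonotonyTheory.incnP u_inc).
  by rewrite eqn_leq !u_le uij lexx.
- by have := (uR (pickle i)).2; rewrite pickleK.
- by rewrite -u0; apply: (Order.NatMonotonyTheory.homo_ltn_lt u_inc).
Qed.

End RegularUncountable.

(** * Hereditarily countable sets up to extensional equality *)

Definition hc_child (x : hc) (i : nat) : option hc := let: HSet u := x in u i.

(** The automatically generated principle has no induction hypothesis for the
    children, which are hidden under [option]. *)
Lemma hc_ind_child (P : hc -> Prop) :
  (forall x, (forall i y, hc_child x i = Some y -> P y) -> P x) -> forall x, P x.
Proof.
move=> IH; fix rec 1 => -[u]; apply: IH => i y /=.
refine (match u i as o return o = Some y -> P y with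
        | Some z => fun zy => eq_ind z P (rec z) y (Some_inj zy)
        | None => fun zy => ltac:(discriminate)
        end).
Qed.

Lemma hc_memE x y :
  hc_mem x y <-> exists j z, hc_child y j = Some z /\ hc_eq x z.
Proof.
case: y => v /=; split=> [[j]|[j [z [vj xz]]]]; last by exists j; rewrite vj.
by case vj: (v j) => [z|//] xz; exists j, z.
Qed.

Lemma hc_eqE x y : hc_eq x y <->
  (forall i x', hc_child x i = Some x' -> hc_mem x' y) /\
  (forall j y', hc_child y j = Some y' ->
     exists i x', hc_child x i = Some x' /\ hc_eq x' y').
Proof.
case: x y => [u] [v] /=; split=> -[uv vu].
  split=> [i x' ui|j y' vj].
    by have := uv i; rewrite ui.
  have := vu j; rewrite vj => -[i]; case ui: (u i) => [x'|//] xy'.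
  by exists i, x'.
split=> [i|j].
  by case ui: (u i) => [x'|//]; exact: uv ui.
case vj: (v j) => [y'|//]; have [i [x' [ui xy']]] := vu _ _ vj.
by exists i; rewrite ui.
Qed.

Lemma hc_eq_refl x : hc_eq x x.
Proof.
elim/hc_ind_child: x => x IH; apply/hc_eqE; split=> [i y xi|i y xi].
  by apply/hc_memE; exists i, y; split=> //; exact: IH xi.
by exists i, y; split=> //; exact: IH xi.
Qed.
#[local] Hint Resolve hc_eq_refl : core.

Lemma hc_eq_sym x y : hc_eq x y -> hc_eq y x.
Proof.
elim/hc_ind_child: x y => x IH y /hc_eqE[xy yx]; apply/hc_eqE.
split=> [j y' /yx[i [x' [xi xy']]]|i x' xi].
  by apply/hc_memE; exists i, x'; split=> //; exact: IH xi _ xy'.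
have /hc_memE[j [y' [yj xy']]] := xy _ _ xi.
by exists j, y'; split=> //; exact: IH xi _ xy'.
Qed.

Lemma hc_eq_trans y x z : hc_eq x y -> hc_eq y z -> hc_eq x z.
Proof.
elim/hc_ind_child: x y z => x IH y z /hc_eqE[xy yx] /hc_eqE[yz zy].
apply/hc_eqE; split=> [i x' xi|k z' /zy[j [y' [/yx[i [x' [xi xy']]] yz']]]].
  have /hc_memE[j [y' [yj xy']]] := xy _ _ xi.
  have /hc_memE[k [z' [zk yz']]] := yz _ _ yj.
  by apply/hc_memE; exists k, z'; split=> //; exact: IH xi _ _ xy' yz'.
by exists i, x'; split=> //; exact: IH xi _ _ xy' yz'.
Qed.

Arguments hc_mem : simpl never.
Arguments hc_eq : simpl never.

Lemma hc_mem_eql x x' y : hc_eq x x' -> hc_mem x' y -> hc_mem x y.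
Proof.
move=> xx' /hc_memE[j [z [yj x'z]]]; apply/hc_memE; exists j, z; split=> //.
exact: hc_eq_trans x'z.
Qed.

Lemma hc_mem_eqr y y' x : hc_eq y y' -> hc_mem x y -> hc_mem x y'.
Proof.
move=> /hc_eqE[yy' _] /hc_memE[j [z [yj xz]]].
exact: hc_mem_eql xz (yy' _ _ yj).
Qed.

Lemma hc_ext x y : (forall z, hc_mem z x <-> hc_mem z y) -> hc_eq x y.
Proof.
move=> xy; apply/hc_eqE; split=> [i x' xi|j y' yj].
  by apply/xy/hc_memE; exists i, x'.
have /xy/hc_memE[i [x' [xi yx']]] : hc_mem y' y by apply/hc_memE; exists j, y'.
by exists i, x'; split=> //; exact: hc_eq_sym.
Qed.

Lemma hc_eqP x y : hc_eq x y <-> forall z, hc_mem z x <-> hc_mem z y.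
Proof.
split=> [xy z|]; last exact: hc_ext.
by split; apply: hc_mem_eqr => //; exact: hc_eq_sym.
Qed.

Lemma hc_mem_empty z : ~ hc_mem z hc_empty.
Proof. by case. Qed.

Lemma hc_mem_adjoin x y z : hc_mem z (hc_adjoin x y) <-> hc_mem z x \/ hc_eq z y.
Proof.
case: x => u; split=> [/hc_memE[[|j] [w /= [wj zw]]]|[/hc_memE[j [w [wj zw]]]|zy]].
- by right; case: wj zw => ->.
- by left; apply/hc_memE; exists j, w.
- by apply/hc_memE; exists j.+1, w.
- by apply/hc_memE; exists 0%N, y.
Qed.

Lemma hc_mem_upair x y z : hc_mem z (hc_upair x y) <-> hc_eq z x \/ hc_eq z y.
Proof.
rewrite /hc_upair !hc_mem_adjoin; split=> [[[/hc_mem_empty|]|]|[]]; by tauto.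
Qed.

Lemma hc_upair_eq x y x' y' : hc_eq x x' -> hc_eq y y' ->
  hc_eq (hc_upair x y) (hc_upair x' y').
Proof.
move=> xx' yy'; apply: hc_ext => z; rewrite !hc_mem_upair.
by split=> -[] zx; [left|right|left|right]; apply: hc_eq_trans zx _ => //;
   exact: hc_eq_sym.
Qed.

Lemma hc_upair_inj x y x' y' : hc_eq (hc_upair x y) (hc_upair x' y') ->
  (hc_eq x x' /\ hc_eq y y') \/ (hc_eq x y' /\ hc_eq y x').
Proof.
move=> /hc_eqP E.
have := (E x).1; have := (E y).1; have := (E x').2; have := (E y').2.
rewrite !hc_mem_upair => /(_ (or_intror (hc_eq_refl _))) y'P.
move=> /(_ (or_introl (hc_eq_refl _))) x'P.
move=> /(_ (or_intror (hc_eq_refl _))) yP /(_ (or_introl (hc_eq_refl _))) xP.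
case: xP => xP; [left|right]; split=> //.
  case: yP => // yP; case: y'P => y'P; last exact: hc_eq_sym.
  exact: hc_eq_trans (hc_eq_trans yP (hc_eq_sym xP)) (hc_eq_sym y'P).
case: yP => // yP; case: x'P => x'P; last exact: hc_eq_sym.
exact: hc_eq_trans (hc_eq_trans yP (hc_eq_sym xP)) (hc_eq_sym x'P).
Qed.

Lemma hc_pair_eq x y x' y' : hc_eq x x' -> hc_eq y y' ->
  hc_eq (hc_pair x y) (hc_pair x' y').
Proof. by move=> xx' yy'; do !apply: hc_upair_eq. Qed.

Lemma hc_pair_inj x y x' y' :
  hc_eq (hc_pair x y) (hc_pair x' y') -> hc_eq x x' /\ hc_eq y y'.
Proof.
move/hc_upair_inj=> [[/hc_upair_inj xx' /hc_upair_inj xy]|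
  [/hc_upair_inj xx'y' /hc_upair_inj xyx']].
  have {}xx' : hc_eq x x' by case: xx' => -[].
  split=> //; case: xy => [[]//|[xy' yx']].
  exact: hc_eq_trans yx' (hc_eq_trans (hc_eq_sym xx') xy').
have [xx' yx'] : hc_eq x x' /\ hc_eq y x' by case: xyx' => -[].
split=> //; apply: hc_eq_trans yx' (hc_eq_trans (hc_eq_sym xx') _).
by case: xx'y' => -[].
Qed.

Lemma hc_mem_nat n z :
  hc_mem z (hc_nat n) <-> exists2 m, (m < n)%N & hc_eq z (hc_nat m).
Proof.
elim: n => [|n IH]; first by split=> [/hc_mem_empty//|[]].
rewrite [hc_nat _]/= hc_mem_adjoin IH; split=> [[[m mn zm]|zn]|[m mn zm]].
- by exists m => //; exact: ltnW.
- by exists n.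
- move: mn zm; rewrite ltnS leq_eqVlt => /predU1P[->|mn] zm; first by right.
  by left; exists m.
Qed.

Lemma hc_nat_inj m n : hc_eq (hc_nat m) (hc_nat n) -> m = n.
Proof.
have irr k : ~ hc_mem (hc_nat k) (hc_nat k).
  elim/ltn_ind: k => k IH /hc_mem_nat[j jk kj]; apply: (IH j jk).
  by apply: hc_mem_eqr kj _; apply/hc_mem_nat; exists j.
move=> mn; apply/eqP; case: ltngtP => // lt; exfalso.
  apply: (irr n); apply: hc_mem_eql (hc_eq_sym mn) _.
  by apply/hc_mem_nat; exists m.
apply: (irr m); apply: hc_mem_eql mn _; by apply/hc_mem_nat; exists n.
Qed.

Lemma hc_mem_set A z : hc_mem z (hc_set A) <-> exists2 m, A m & hc_eq z (hc_nat m).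
Proof.
split=> [/hc_memE[m [w /= [+ zw]]]|[m Am zm]].
  by case: ifP => // /set_mem Am [wE]; exists m => //; rewrite wE.
by apply/hc_memE; exists m, (hc_nat m); rewrite /= mem_set.
Qed.

Lemma hc_nat_mem_set A m : hc_mem (hc_nat m) (hc_set A) <-> A m.
Proof.
rewrite hc_mem_set; split=> [[n An /hc_nat_inj ->]//|Am]; by exists m.
Qed.

Lemma hc_set_inj A B : hc_eq (hc_set A) (hc_set B) -> A = B.
Proof.
by move=> /hc_eqP E; apply/seteqP; split=> m /hc_nat_mem_set/E/hc_nat_mem_set.
Qed.

Definition hc_omega : hc := hc_set [set: nat].

Lemma hc_mem_omega z : hc_mem z hc_omega <-> exists m, hc_eq z (hc_nat m).
Proof. by rewrite hc_mem_set; split=> [[m _]|[m]]; exists m. Qed.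

Lemma hc_set_of_mem w : (forall v, hc_mem v w -> hc_mem v hc_omega) ->
  hc_eq w (hc_set [set m | hc_mem (hc_nat m) w]).
Proof.
move=> sub; apply: hc_ext => v; rewrite hc_mem_set; split=> [vw|[m mw vm]].
  have /hc_mem_omega[m vm] := sub v vw; exists m => //=.
  exact: hc_mem_eql (hc_eq_sym vm) vw.
exact: hc_mem_eql vm mw.
Qed.

Lemma hc_mem_tuple n (x : 'I_n -> hc) z :
  hc_mem z (hc_tuple x) <-> exists j : 'I_n, hc_eq z (hc_pair (hc_nat j) (x j)).
Proof.
split=> [/hc_memE[i [w /= [+ zw]]]|[j zj]].
  by case: insubP => [j _ _|] //= [wE]; exists j; rewrite wE.
by apply/hc_memE; exists (val j), (hc_pair (hc_nat j) (x j)); rewrite /= valK.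
Qed.

(** * Formulas

  Every formula comes with a lemma giving its meaning in an arbitrary
  environment, the arguments being de Bruijn indices. *)

Definition f_all p := FNot (FEx (FNot p)).
Definition f_or p q := FNot (FAnd (FNot p) (FNot q)).
Definition f_imp p q := FNot (FAnd p (FNot q)).
Definition f_iff p q := FAnd (f_imp p q) (f_imp q p).

Lemma sat_and e p q : sat e (FAnd p q) <-> sat e p /\ sat e q.
Proof. by []. Qed.

Lemma sat_ex e p : sat e (FEx p) <-> exists x, sat (x :: e) p.
Proof. by []. Qed.

Lemma sat_all e p : sat e (f_all p) <-> forall x, sat (x :: e) p.
Proof. by rewrite /= -forallNP; split=> H x; [apply: contrapT|]. Qed.

Lemma sat_or e p q : sat e (f_or p q) <-> sat e p \/ sat e q.
Proof. by rewrite /= not_andE !notE. Qed.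

Lemma sat_imp e p q : sat e (f_imp p q) <-> (sat e p -> sat e q).
Proof. by rewrite /=; split=> [H sp|H [/H]//]; apply: contrapT => nq; apply: H. Qed.

Lemma sat_iff e p q : sat e (f_iff p q) <-> (sat e p <-> sat e q).
Proof.
split=> [[/sat_imp pq /sat_imp qp]|[pq qp]]; first by split.
by split; apply/sat_imp.
Qed.

Definition f_upair k i j :=
  f_all (f_iff (FMem 0 k.+1) (f_or (FEq 0 i.+1) (FEq 0 j.+1))).

Definition f_pair k i j :=
  f_all (f_iff (FMem 0 k.+1)
               (f_or (f_upair 0 i.+1 i.+1) (f_upair 0 i.+1 j.+1))).

Definition f_pair_mem i j s := FEx (FAnd (f_pair 0 i.+1 j.+1) (FMem 0 s.+1)).

Definition f_sub w o := f_all (f_imp (FMem 0 w.+1) (FMem 0 o.+1)).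

Local Notation "e .[ i ]" := (nth hc_empty e i).

Lemma sat_upair e k i j :
  sat e (f_upair k i j) <-> hc_eq e.[k] (hc_upair e.[i] e.[j]).
Proof.
rewrite /f_upair sat_all hc_eqP; setoid_rewrite sat_iff.
by setoid_rewrite sat_or; setoid_rewrite hc_mem_upair.
Qed.

Lemma sat_pair e k i j :
  sat e (f_pair k i j) <-> hc_eq e.[k] (hc_pair e.[i] e.[j]).
Proof.
rewrite /f_pair sat_all hc_eqP; setoid_rewrite sat_iff.
by setoid_rewrite sat_or; setoid_rewrite sat_upair; setoid_rewrite hc_mem_upair.
Qed.

Lemma sat_pair_mem e i j s :
  sat e (f_pair_mem i j s) <-> hc_mem (hc_pair e.[i] e.[j]) e.[s].
Proof.
split=> [[p [/sat_pair pE ps]]|H]; first exact: hc_mem_eql (hc_eq_sym pE) ps.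
by exists (hc_pair e.[i] e.[j]); split=> //; apply/sat_pair.
Qed.

Definition hc_sub (x y : hc) : Prop := forall v, hc_mem v x -> hc_mem v y.

Lemma sat_sub e w o : sat e (f_sub w o) <-> hc_sub e.[w] e.[o].
Proof. by rewrite /f_sub sat_all; setoid_rewrite sat_imp. Qed.

(** For [N] a numeral and [o] the set omega, this expresses that [s] is an
    injective sequence of length [N] of subsets of omega. *)
Definition hc_injection (N s o : hc) : Prop :=
  (forall p, hc_mem p s -> exists i w,
     hc_mem i N /\ hc_eq p (hc_pair i w) /\ hc_sub w o) /\
  (forall i, hc_mem i N -> exists w, hc_mem (hc_pair i w) s) /\
  (forall i w w', hc_mem (hc_pair i w) s -> hc_mem (hc_pair i w') s ->
     hc_eq w w') /\
  (forall i i' w, hc_mem (hc_pair i w) s -> hc_mem (hc_pair i' w) s ->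
     hc_eq i i').

Definition f_injection (N s o : nat) : formula :=
  FAnd (f_all (f_imp (FMem 0 s.+1)
     (FEx (FEx (FAnd (FMem 1 N.+3) (FAnd (f_pair 2 1 0) (f_sub 0 o.+3)))))))
 (FAnd (f_all (f_imp (FMem 0 N.+1) (FEx (f_pair_mem 1 0 s.+2))))
 (FAnd (f_all (f_all (f_all (f_imp (f_pair_mem 2 1 s.+3)
                            (f_imp (f_pair_mem 2 0 s.+3) (FEq 1 0))))))
       (f_all (f_all (f_all (f_imp (f_pair_mem 2 0 s.+3)
                            (f_imp (f_pair_mem 1 0 s.+3) (FEq 2 1)))))))).

Lemma sat_injection e N s o :
  sat e (f_injection N s o) <-> hc_injection e.[N] e.[s] e.[o].
Proof.
rewrite /f_injection !sat_and.
repeat setoid_rewrite sat_all.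
repeat setoid_rewrite sat_imp.
repeat setoid_rewrite sat_ex.
repeat setoid_rewrite sat_and.
repeat setoid_rewrite sat_pair_mem.
repeat setoid_rewrite sat_pair.
by repeat setoid_rewrite sat_sub.
Qed.

(** [P] is a set of quadruples of numbers, a quadruple [(N, m, i, q)] being read
    as the following requirement for [m] to belong to the value at a sequence [s]
    of length [N]: the number [q] belongs to the [i]-th term of [s]. *)
Definition hc_satisfies (N s P m : hc) : Prop :=
  forall i q, hc_mem i N -> hc_mem (hc_pair (hc_pair N m) (hc_pair i q)) P ->
  exists w, hc_mem (hc_pair i w) s /\ hc_mem q w.

Definition f_satisfies (N s P m : nat) : formula :=
  f_all (f_all (f_imp (FMem 1 N.+2) (f_imp
    (FEx (FEx (FAnd (f_pair 1 N.+4 m.+4)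
              (FAnd (f_pair 0 3 2) (f_pair_mem 1 0 P.+4)))))
    (FEx (FAnd (f_pair_mem 2 0 s.+3) (FMem 1 0)))))).

Lemma sat_satisfies e N s P m :
  sat e (f_satisfies N s P m) <-> hc_satisfies e.[N] e.[s] e.[P] e.[m].
Proof.
rewrite /f_satisfies.
repeat setoid_rewrite sat_all.
repeat setoid_rewrite sat_imp.
repeat setoid_rewrite sat_ex.
repeat setoid_rewrite sat_and.
repeat setoid_rewrite sat_pair_mem.
repeat setoid_rewrite sat_pair.
split=> H i q iN => [iP|[u [v [uE [vE uvP]]]]]; apply: (H i q iN).
  by exists (hc_pair e.[N] e.[m]), (hc_pair i q).
by apply: hc_mem_eql uvP; apply: hc_pair_eq; exact: hc_eq_sym.
Qed.

(** Variables: 0 length, 1 value, 2 sequence, 3 relation, 4 omega, 5 element of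
    the graph, 6 parameter. *)
Definition f_graph_matrix : formula :=
  FAnd (f_pair 6 4 3)
 (FAnd (f_pair 5 2 1)
 (FAnd (FMem 0 4)
 (FAnd (f_injection 0 2 4)
 (FAnd (f_sub 1 4)
       (f_all (f_imp (FMem 0 5) (f_iff (FMem 0 2) (f_satisfies 1 3 4 0)))))))).

Definition f_graph : formula := FEx (FEx (FEx (FEx (FEx f_graph_matrix)))).

Lemma sat_graph z a : sat [:: z; a] f_graph <->
  exists o P s y N, hc_eq a (hc_pair o P) /\ hc_eq z (hc_pair s y) /\
    hc_mem N o /\ hc_injection N s o /\ hc_sub y o /\
    forall m, hc_mem m o -> (hc_mem m y <-> hc_satisfies N s P m).
Proof.
rewrite /f_graph; repeat setoid_rewrite sat_ex.
suff E o P s y N : sat [:: N; y; s; P; o; z; a] f_graph_matrix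
  <-> hc_eq a (hc_pair o P) /\ hc_eq z (hc_pair s y) /\
    hc_mem N o /\ hc_injection N s o /\ hc_sub y o /\
    forall m, hc_mem m o -> (hc_mem m y <-> hc_satisfies N s P m).
  by setoid_rewrite E.
rewrite /f_graph_matrix 4!sat_and !sat_pair sat_injection sat_and sat_sub sat_all.
by setoid_rewrite sat_imp; setoid_rewrite sat_iff; setoid_rewrite sat_satisfies.
Qed.

(** * Functions given by a relation on numbers *)

Definition hc_rel (R : nat -> nat -> nat -> nat -> Prop) : hc :=
  HSet (fun c => if unpickle c is Some (n, m, i, q) then
    if `[< R n m i q >] then
      Some (hc_pair (hc_pair (hc_nat n) (hc_nat m))
                    (hc_pair (hc_nat i) (hc_nat q)))
    else None else None).

Lemma hc_mem_rel R n m i q :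
  hc_mem (hc_pair (hc_pair (hc_nat n) (hc_nat m))
                  (hc_pair (hc_nat i) (hc_nat q)))
    (hc_rel R) <-> R n m i q.
Proof.
split=> [/hc_memE[c [w /= [+ H]]]|Rnmiq]; last first.
  apply/hc_memE; exists (pickle (n, m, i, q)); rewrite /= pickleK asboolT //.
  by eexists.
case: unpickle => [[[[n' m'] i'] q']|//].
case: asboolP => // R' [wE]; move: H; rewrite -wE.
move=> /hc_pair_inj[/hc_pair_inj[/hc_nat_inj-> /hc_nat_inj->]].
by move=> /hc_pair_inj[/hc_nat_inj-> /hc_nat_inj->].
Qed.

(** [R n m i q] requires the [i]-th argument to contain [q] for [m] to be in the
    value at an [n]-tuple; in this form all the arithmetic is left to [R]. *)
Definition rel_fun (R : nat -> nat -> nat -> nat -> Prop) : tuple_fun :=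
  fun n x => [set m | forall (i : 'I_n) q, R n m i q -> x i q].

Definition hc_real_tuple n (x : 'I_n -> set nat) : hc :=
  hc_tuple (fun i => hc_set (x i)).

Lemma hc_pair_mem_tuple n (x : 'I_n -> set nat) i w :
  hc_mem (hc_pair i w) (hc_real_tuple x) <->
  exists j : 'I_n, hc_eq i (hc_nat j) /\ hc_eq w (hc_set (x j)).
Proof.
rewrite hc_mem_tuple; split=> [[j /hc_pair_inj[]]|[j [ij wj]]]; exists j => //.
exact: hc_pair_eq.
Qed.

Lemma ord_nat_inj n (i j : 'I_n) : hc_eq (hc_nat i) (hc_nat j) -> i = j.
Proof. by move/hc_nat_inj/val_inj. Qed.

Lemma hc_injection_tuple n (x : 'I_n -> set nat) : injective x ->
  hc_injection (hc_nat n) (hc_real_tuple x) hc_omega.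
Proof.
move=> x_inj; split; [|split; [|split]].
- move=> p /hc_mem_tuple[j pj]; exists (hc_nat j), (hc_set (x j)).
  split; first by apply/hc_mem_nat; exists j.
  by split=> // v /hc_mem_set[m _ vm]; apply/hc_mem_omega; exists m.
- move=> i /hc_mem_nat[j jn ij]; exists (hc_set (x (Ordinal jn))).
  by apply/hc_pair_mem_tuple; exists (Ordinal jn).
- move=> i w w' /hc_pair_mem_tuple[j [ij wj]] /hc_pair_mem_tuple[j' [ij' wj']].
  have jj' := ord_nat_inj (hc_eq_trans (hc_eq_sym ij) ij').
  by apply: hc_eq_trans wj (hc_eq_sym _); rewrite jj'.
- move=> i i' w /hc_pair_mem_tuple[j [ij wj]] /hc_pair_mem_tuple[j' [ij' wj']].
  have /x_inj jj' := hc_set_inj (hc_eq_trans (hc_eq_sym wj) wj').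
  by apply: hc_eq_trans ij (hc_eq_sym _); rewrite jj'.
Qed.

(** The [i]-th term [w] of the sequence [s] is recovered as the set of those [m]
    whose numeral belongs to [w]. *)
Lemma hc_injectionP n N s o :
    hc_eq N (hc_nat n) -> hc_eq o hc_omega -> hc_injection N s o ->
  exists2 x : 'I_n -> set nat, injective x & hc_eq s (hc_real_tuple x).
Proof.
move=> Nn oE [s_rel [s_tot [s_fun s_inj]]].
have /choice [w wP] : forall j : 'I_n, exists w, hc_mem (hc_pair (hc_nat j) w) s.
  move=> j; apply: s_tot; apply: hc_mem_eqr (hc_eq_sym Nn) _.
  by apply/hc_mem_nat; exists j.
pose x j := [set m | hc_mem (hc_nat m) (w j)].
have wE j : hc_eq (w j) (hc_set (x j)).
  apply: hc_set_of_mem => v vw.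
  have [i [w' [iN [/hc_pair_inj[_ ww'] w'o]]]] := s_rel _ (wP j).
  by apply: hc_mem_eqr oE _; apply: w'o; exact: hc_mem_eqr ww' vw.
exists x => [i j xij|].
  apply: ord_nat_inj; apply: (s_inj _ _ (w i)) => //.
  apply: hc_mem_eql (wP j); apply: hc_pair_eq => //.
  by apply: hc_eq_trans (wE i) (hc_eq_sym _); rewrite xij.
apply: hc_ext => p; rewrite hc_mem_tuple; split=> [ps|[j pj]].
  have [i [w' [iN [pE w'o]]]] := s_rel _ ps.
  have /hc_mem_nat[j jn ij] := hc_mem_eqr Nn iN.
  exists (Ordinal jn); apply: (hc_eq_trans pE); apply: hc_pair_eq => //.
  apply: hc_eq_trans (wE _); apply: (s_fun (hc_nat j)).
    2: exact: (wP (Ordinal jn)).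
  apply: hc_mem_eql ps; apply: hc_eq_trans (hc_eq_sym pE).
  by apply: hc_pair_eq => //; exact: hc_eq_sym.
apply: hc_mem_eql pj _; apply: hc_mem_eql (wP j); apply: hc_pair_eq => //.
exact: hc_eq_sym.
Qed.

Lemma hc_satisfiesP R n (x : 'I_n -> set nat) N s P k m :
    hc_eq N (hc_nat n) -> hc_eq s (hc_real_tuple x) -> hc_eq P (hc_rel R) ->
    hc_eq k (hc_nat m) ->
  hc_satisfies N s P k <-> rel_fun R x m.
Proof.
move=> Nn sx PR km; split=> [H j q Rq|gm i q iN].
  have [||w [iw qw]] := H (hc_nat j) (hc_nat q).
  - by apply: hc_mem_eqr (hc_eq_sym Nn) _; apply/hc_mem_nat; exists j.
  - apply: hc_mem_eqr (hc_eq_sym PR) _.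
    have /hc_mem_rel := Rq; apply: hc_mem_eql.
    by apply: hc_pair_eq => //; exact: hc_pair_eq.
  have /hc_pair_mem_tuple[j' [/ord_nat_inj <- wj]] := hc_mem_eqr sx iw.
  by apply/hc_nat_mem_set; exact: hc_mem_eqr wj qw.
have /hc_mem_nat[j jn ij] := hc_mem_eqr Nn iN.
move=> /(hc_mem_eqr PR) qP.
have [l qE] : exists l, hc_eq q (hc_nat l).
  have /hc_memE[c [w [/= cw wE]]] := qP.
  move: cw wE; case: unpickle => [[[[? ?] ?] l]|//]; case: asboolP => // _ [<-].
  by move=> /hc_pair_inj[_ /hc_pair_inj[_ ql]]; exists l.
have Rl : R n m j l.
  apply/hc_mem_rel; apply: hc_mem_eql qP.
  by apply: hc_pair_eq; apply: hc_pair_eq; exact: hc_eq_sym.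
exists (hc_set (x (Ordinal jn))); split.
  apply: hc_mem_eqr (hc_eq_sym sx) _.
  by apply/hc_pair_mem_tuple; exists (Ordinal jn).
by apply: hc_mem_eql qE _; apply/hc_nat_mem_set; exact: (gm (Ordinal jn)).
Qed.

(** The relation [R] can be arbitrary, since as a countable set of quadruples of
    numbers it is allowed as a parameter; omega is passed along with it. *)
Lemma definable_rel_fun R : definable_fun (rel_fun R).
Proof.
exists f_graph, (hc_pair hc_omega (hc_rel R)) => z; rewrite sat_graph.
split=> [[n [x [x_inj zE]]]|].
  exists hc_omega, (hc_rel R), (hc_real_tuple x), (hc_set (rel_fun R x)), (hc_nat n).
  do !split=> //.
  - by apply/hc_mem_omega; exists n.
  - by case: (hc_injection_tuple x_inj).
  - by case: (hc_injection_tuple x_inj) => _ [].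
  - by case: (hc_injection_tuple x_inj) => _ [_ []].
  - by case: (hc_injection_tuple x_inj) => _ [_ []].
  - by move=> v /hc_mem_set[m _ vm]; apply/hc_mem_omega; exists m.
  - move=> /hc_mem_set[l gl ml]; exact/(hc_satisfiesP _ _ _ ml).
  - have /hc_mem_omega[l ml] := H.
    move=> /(hc_satisfiesP _ _ _ ml) gl; apply/hc_mem_set; exists l => //.
    exact: gl.
move=> [o [P [s [y [N [/hc_pair_inj[oE PE] [zE [No [injs [yo yP]]]]]]]]]].
have /hc_mem_omega[n Nn] := hc_mem_eqr (hc_eq_sym oE) No.
have [x x_inj sx] := hc_injectionP Nn (hc_eq_sym oE) injs.
exists n, x; split=> //; apply: hc_eq_trans zE _; apply: hc_pair_eq => //.
apply: hc_ext => v; split=> [vy|].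
  have vo := yo _ vy; have /hc_mem_omega[m vm] := hc_mem_eqr (hc_eq_sym oE) vo.
  apply/hc_mem_set; exists m => //.
  by apply/(hc_satisfiesP Nn sx (hc_eq_sym PE) vm)/yP.
move=> /hc_mem_set[m gm vm].
apply/yP; last exact/(hc_satisfiesP Nn sx (hc_eq_sym PE) vm).
by apply: hc_mem_eqr oE _; apply/hc_mem_omega; exists m.
Qed.

(** * Meets along sequences as values of one function *)

(** A real coding two sequences of subsets of omega: in the application [u] is
    there to make the code injective, and [v] is a row of the matrix. *)
Definition pair_code (u v : nat -> set nat) : set nat :=
  [set c | if unpickle c is Some (s, n, m)
           then (if s then u n m else v n m : Prop) else False].

Lemma pair_codeE u v (s : bool) n m :
  pair_code u v (pickle (s, n, m)) = (if s then u n m else v n m).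
Proof. by rewrite /pair_code /= pickleK. Qed.

Lemma pair_code_injl u v u' v' : pair_code u v = pair_code u' v' -> u = u'.
Proof.
move=> E; apply/funext => n; apply/funext => m.
by have := pair_codeE u v true n m; rewrite E pair_codeE.
Qed.

(** [CodeSeq.code s] exceeds all the entries of [s]; having [size t] among them
    ensures that a tuple of length [arity t] has enough arguments for [t]. *)
Definition arity (t : seq nat) : nat := CodeSeq.code (size t :: t).

Lemma size_lt_arity t : (size t < arity t)%N.
Proof. by have /andP[] := CodeSeq.ltn_code (size t :: t). Qed.

Lemma arity_inj : injective arity.
Proof. by move=> t t' /(can_inj CodeSeq.codeK)[]. Qed.

(** The requirements for [m] to be in the meet along the [t] of arity [n]: column
    [nth 0 t i] of the row coded by the [i]-th argument must contain [m]. *)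
Definition meet_rel (T : set (seq nat)) (n m i q : nat) : Prop :=
  exists t, [/\ T t, n = arity t, (i < size t)%N &
                q = pickle (false, nth 0%N t i, m)].

Lemma rel_fun_meet (K : Type) (T : set (seq nat)) (e a : K -> nat -> set nat) t
    (alpha : 'I_(arity t) -> K) : T t ->
  rel_fun (meet_rel T) (fun i => pair_code (e (alpha i)) (a (alpha i))) =
  meet_along a
    (fun i : 'I_(size t) => alpha (widen_ord (ltnW (size_lt_arity t)) i)).
Proof.
move=> Tt; apply/seteqP; split=> [m H i _|m H i q [t' [Tt' /arity_inj <- it ->]]].
  by have := H (widen_ord (ltnW (size_lt_arity t)) i) _
    (ex_intro _ t (And4 Tt erefl (ltn_ord i) erefl)); rewrite pair_codeE.
rewrite pair_codeE; have := H (Ordinal it) I.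
by congr (a (alpha _) _ m); apply/val_inj.
Qed.

Lemma rel_fun_meet_trivial (T : set (seq nat)) n (x : 'I_n -> set nat) :
  ~ (exists2 t, T t & n = arity t) -> rel_fun (meet_rel T) x = setT.
Proof.
move=> nT; apply/seteqP; split=> // m _ i q [t [Tt nt _ _]].
by case: nT; exists t.
Qed.

Lemma inj_prod_comp (K : Type) (U : Type) (f : K -> U) k (S : 'I_k -> set K) alpha :
  injective f -> inj_prod S alpha -> inj_prod (fun i => f @` S i) (f \o alpha).
Proof.
move=> f_inj [alpha_inj alphaS]; split; first exact: inj_comp.
by move=> i; exists (alpha i).
Qed.

(** The new terms are pairwise distinct elements of the stationary sets [S i],
    chosen above all the given ones. *)
Lemma extend_tuples d (K : orderType d) (hK : regular_uncountable K) n k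
    (le_nk : (n <= k)%N) (S : 'I_k -> set K)
    (alpha beta : 'I_n -> K) : (forall i, stationary (S i)) ->
    inj_prod (fun i => S (widen_ord le_nk i)) alpha ->
    inj_prod (fun i => S (widen_ord le_nk i)) beta ->
    (forall i, alpha i <> beta i) ->
  exists alpha' beta' : 'I_k -> K,
    [/\ inj_prod S alpha', inj_prod S beta', forall i, alpha' i <> beta' i,
        forall i, alpha' (widen_ord le_nk i) = alpha i &
        forall i, beta' (widen_ord le_nk i) = beta i].
Proof.
move=> statS [alpha_inj alphaS] [beta_inj betaS] ab.
have [b bP] := countable_bounded hK (fun p : 'I_n * bool =>
  if p.2 then alpha p.1 else beta p.1).
have [|w [w_inj wS bw]] :=
    @fresh_points _ K hK ('I_k * bool)%type (fun p => S p.1) b.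
  by move=> [i ?] c /=; exact: stationary_unbounded.
pose ext s (gamma : 'I_n -> K) (i : 'I_k) :=
  if insub (val i) is Some j then gamma j else w (i, s).
have ext_widen s gamma i : ext s gamma (widen_ord le_nk i) = gamma i.
  by rewrite /ext /= valK.
have extP s gamma : injective gamma -> (forall i, S (widen_ord le_nk i) (gamma i)) ->
    (forall i, (gamma i < b)%O) -> inj_prod S (ext s gamma).
  move=> g_inj gS gb; split=> [i j|i]; rewrite /ext.
    case: insubP => [i' _ ii'|_]; case: insubP => [j' _ jj'|_] //.
    - by move=> /g_inj E; apply/val_inj; rewrite -ii' -jj' E.
    - by move=> E; have := lt_trans (gb i') (bw (j, s)); rewrite E ltxx.
    - by move=> E; have := lt_trans (gb j') (bw (i, s)); rewrite E ltxx.
    - by move=> /w_inj[].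
  case: insubP => [i' _ ii'|_]; last exact: (wS (i, s)).
  by have := gS i'; congr (S _ _); apply/val_inj.
exists (ext true alpha), (ext false beta); split=> //.
- by apply: extP => // i; exact: (bP (i, true)).
- by apply: extP => // i; exact: (bP (i, false)).
- move=> i; rewrite /ext; case: insubP => [i' _ _|_]; first exact: ab.
  by move=> /w_inj.
Qed.

Theorem theorem2p8 (d : Order.disp_t) (K : orderType d)
    (hK : regular_uncountable K)
    (d' : Order.disp_t) (L : orderType d') (hL : is_aleph1 L) :
  IP K L -> Fs K.
Proof.
move=> ip T a.
have [[b statS]|[e e_inj]] := stationary_fibre_or_injection hK a.
  (* All the rows over this stationary set are the row of [b], so a meet depends
     only on the sequence in [T]. *)
  left; exists [set c | a c = a b]; split=> //.
  pose F t := \bigcap_(i in [set: 'I_(size t)]) a b (nth 0%N t i).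
  apply: (@sub_countable _ _ _ (F @` T)).
    apply: subset_card_le => X [t [alpha [Tt [_ alphaS] ->]]].
    by exists t => //; apply: eq_bigcapr => i _; rewrite alphaS.
  by apply: sub_countable (countableP T); exact: card_image_le.
pose f c := pair_code (e c) (a c).
have f_inj : injective f by move=> c c' /pair_code_injl/e_inj.
have [[S [statS Scount]]|[k [S [k_gt0 statS gS]]]] :=
    ip f _ (definable_rel_fun (meet_rel T)).
  left; exists S; split=> //.
  set g := rel_fun (meet_rel T) in Scount.
  apply: (@sub_countable _ _ _ (\bigcup_n (g n @` inj_tuples (f @` S)))); last first.
    by apply: bigcup_countable => // n _; exact: card_lt_aleph1_countable (Scount n).
  apply: subset_card_le => X [t [alpha [Tt [alpha_inj alphaS] ->]]].
  (* [extend_tuples] extends two tuples at once, so [alpha] needs a companion. *)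
  have [b ab] := countable_bounded hK alpha.
  have [|beta [beta_inj betaS bbeta]] :=
      @fresh_points _ K hK _ (fun _ : 'I_(size t) => S) b.
    by move=> _ c; exact: stationary_unbounded.
  have [|||i E|alpha' [_ [alpha'_in _ _ alpha'E _]]] :=
      @extend_tuples _ K hK _ _ (ltnW (size_lt_arity t)) (fun=> S) alpha beta.
  - by [].
  - by split.
  - by split.
  - by have := lt_trans (ab i) (bbeta i); rewrite E ltxx.
  exists (arity t) => //; exists (f \o alpha'); first exact: inj_prod_comp.
  by rewrite /g rel_fun_meet //; congr meet_along; apply: funext.
have separated n (le_nk : (n <= k)%N) (alpha beta : 'I_n -> K) :
    inj_prod (fun i => S (widen_ord le_nk i)) alpha ->
    inj_prod (fun i => S (widen_ord le_nk i)) beta ->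
    (forall i, alpha i <> beta i) ->
  exists alpha' beta' : 'I_k -> K,
    [/\ rel_fun (meet_rel T) (f \o alpha') <> rel_fun (meet_rel T) (f \o beta'),
        forall i, alpha' (widen_ord le_nk i) = alpha i &
        forall i, beta' (widen_ord le_nk i) = beta i].
  move=> alphaP betaP ab.
  have [alpha' [beta' [alpha'P beta'P ab' alphaE betaE]]] :=
    extend_tuples hK statS alphaP betaP ab.
  exists alpha', beta'; split=> //.
  apply: gS => [||i /f_inj]; last exact: ab'.
    exact: inj_prod_comp.
  exact: inj_prod_comp.
have [[t Tt kE]|nT] := pselect (exists2 t, T t & k = arity t); last first.
  (* Extending the empty tuple twice yields two distinct values of [g] at length
     [k], where it is constant. *)
  pose nil0 (i : 'I_0) := False_rect K (notF (ltn_ord i)).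
  have [|||] := @separated 0%N (leq0n k) nil0 nil0.
  - by split=> -[].
  - by split=> -[].
  - by case.
  by move=> alpha' [beta' []]; rewrite !rel_fun_meet_trivial.
right; subst k; exists t, (fun i => S (widen_ord (ltnW (size_lt_arity t)) i)).
split=> // alpha beta alphaP betaP ab.
have [alpha' [beta' [neq alphaE betaE]]] := separated _ _ _ _ alphaP betaP ab.
rewrite -(funext alphaE) -(funext betaE) => meets_eq; apply: neq.
by rewrite !rel_fun_meet.
Qed.
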